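(* For an even integer $n \geq 4$, let $b_n$ denote the number of bent functions in $n$ variables. Then $$\log_2 b_n \;\geq\; n \cdot 2^{\frac{n}{2}} \left(1 + O\left(\frac{1}{n}\right)\right),$$ that is, there is an absolute constant $C > 0$ such that for every even integer $n \geq 4$, $$\log_2 b_n \;\geq\; n \cdot 2^{\frac{n}{2}} \left(1 - \frac{C}{n}\right).$$
   Context: A Boolean function in $n$ variables is a function $f : \mathbb{F}_2^n \to \mathbb{F}_2$. Its Walsh transform is the function $W_f : \mathbb{F}_2^n \to \mathbb{Z}$ given by $$W_f(y) = \sum_{x \in \mathbb{F}_2^n} (-1)^{f(x) \oplus \langle x, y \rangle},$$ where $\langle x, y \rangle = \sum_i x_i y_i \in \mathbb{F}_2$ is the standard inner product and $\oplus$ is addition in $\mathbb{F}_2$. For even $n$, $f$ is called bent if $W_f(y) \in \{2^{n/2}, -2^{n/2}\}$ for all $y \in \mathbb{F}_2^n$. The number $b_n$ is the number of functions $f : \mathbb{F}_2^n \to \mathbb{F}_2$ that are bent. *)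

(* Defs.v *)
From HB Require Import structures.
From mathcomp Require Import all_boot all_order all_algebra.
From mathcomp Require Import all_classical all_reals all_analysis.

Set Implicit Arguments.
Unset Strict Implicit.
Unset Printing Implicit Defensive.

Import Order.TTheory GRing.Theory Num.Theory.

Local Open Scope ring_scope.

Definition boolean_function (n : nat) := {ffun 'rV['F_2]_n -> 'F_2}.

Definition inner_product (n : nat) (x y : 'rV['F_2]_n) : 'F_2 :=
  \sum_(i < n) x 0 i * y 0 i.

(* The exponent is computed in 'F_2 and then read as the natural number 0 or
   1 through the coercion from ordinals to nat. *)
Definition walsh (n : nat) (f : boolean_function n) (y : 'rV['F_2]_n) : int :=
  \sum_(x : 'rV['F_2]_n) (-1) ^+ nat_of_ord (f x + inner_product x y).

(* Only meaningful for even n: n./2 is the rounded-down half of n. *)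
Definition bent (n : nat) (f : boolean_function n) : bool :=
  [forall y : 'rV['F_2]_n,
     (walsh f y == 2 ^+ n./2) || (walsh f y == - 2 ^+ n./2)].

Definition num_bent (n : nat) : nat := #|[set f : boolean_function n | bent f]|.

Definition log2 (R : realType) (x : R) : R := ln x / ln 2.

(* Main.v *)
Require Import Defs.
From HB Require Import structures.
From mathcomp Require Import all_boot all_order all_algebra all_fingroup.
From mathcomp Require Import all_classical all_reals all_analysis.
From mathcomp Require Import zify ring lra.

Set Implicit Arguments.
Unset Strict Implicit.
Unset Printing Implicit Defensive.

Import Order.TTheory GRing.Theory Num.Theory.

Local Open Scope ring_scope.

(** Why the bound holds.

    Write n = 2 (t + 2), let V be F_2^t with K = 2^t points and let T be F_2^2
    with its four points.  A pair of arguments of a function in n variables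
    is read as (x, xi) in V x T and (y, z) in V x T.  Take a 4 x 4 array of
    permutations P z w of V (z, w in T) and put
      f (x, xi, y, z) = majority over w of
                        [z = w] + <P z w y, x> + <w, xi>.
    If every row of the array sums to zero, the four bits in the majority
    have sum 1, and for four such bits twice the sign of the majority is the
    sum of the four signs (chi_majority).  Hence, for (y, z) fixed, the
    function of (x, xi) has exactly four nonzero Walsh coefficients, at the
    points (P z w y, w).  For a given point (u, om) the only (y, z) that
    contribute to the Walsh transform of f are the four pairs
    ((P z om)^-1 u, z).  If the inverses in every column of the array also
    sum to zero, the four contributions are again four signs with product
    -1, so they add up to twice a sign, and f is bent
    (array_function_bent).  Rows and columns play the same role: the pairs
    (y, z) and (u, om) form a 4-regular bipartite graph in which all
    neighbourhoods are affine planes.  The array can be read off from f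
    (array_function_inj), so it remains to count the arrays.

    The count uses the Cauchy-Schwarz inequality twice.  If phi maps a finite
    set A to a finite group G of exponent 2, at least |A|^4 / |G| quadruples
    in A have phi-sum zero (zero_sum_count).  For permutations this gives at
    least K!^4 / K^K rows.  Applied again to the set of rows, with phi the
    quadruple of inverses, it gives at least K!^16 / K^(8K) arrays.  As
    K! >= (K/4)^K, this is at least K^(8K) / 2^(32K).  Since 8 K t is
    n 2^(n/2) up to a multiple of 2^(n/2), the claim follows; the constant
    obtained is 12.  The point is that sixteen permutations subject to eight
    equations leave about K^(8K) choices, twice the exponent of the
    Maiorana-McFarland family, while each permutation costs only a
    factor exponential in K. *)

(** * Zero-sum quadruples *)

(* The groups of constraints are groups of finite functions, so they have to be
   finite and abelian groups at the same time. *)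
HB.instance Definition _ (aT : finType) (rT : finZmodType) :=
  Finite.on {ffun aT -> rT}.

Lemma sqr_sum_le (I : finType) (r : I -> nat) :
  ((\sum_i r i) ^ 2 <= #|I| * \sum_i r i ^ 2)%N.
Proof.
rewrite -(leq_pmul2l (isT : (0 < 2)%N)).
have -> : (2 * (\sum_i r i) ^ 2 = \sum_i \sum_j 2 * (r i * r j))%N.
  rewrite expnS expn1 big_distrl big_distrr; apply: eq_bigr => i _ /=.
  by rewrite big_distrr big_distrr.
have -> : (2 * (#|I| * \sum_i r i ^ 2) = \sum_i \sum_j (r i ^ 2 + r j ^ 2))%N.
  under [RHS]eq_bigr do rewrite big_split sum_nat_const /=.
  by rewrite big_split sum_nat_const /= -big_distrr /= mul2n -addnn.
by do 2 apply: leq_sum => ? _; exact: nat_Cauchy.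
Qed.

(** The collision form of the Cauchy-Schwarz inequality: the squared sizes of
    the fibres of psi add up to the number of colliding pairs. *)
Lemma collision_count (X G : finType) (A : {set X}) (psi : X -> G) :
  (#|A| ^ 2 <=
     #|G| * #|[set p : X * X | [&& p.1 \in A, p.2 \in A & psi p.1 == psi p.2]]|)%N.
Proof.
pose r g := #|[set x in A | psi x == g]|.
have -> : #|A| = (\sum_g r g)%N.
  rewrite -sum1_card (partition_big psi xpredT) //=.
  by apply: eq_bigr => g _; rewrite sum1dep_card.
apply: leq_trans (sqr_sum_le r) _; rewrite leq_mul2l; apply/orP; right.
rewrite -[leqRHS]sum1_card (partition_big (fun p => psi p.1) xpredT) //=.
apply: leq_sum => g _; rewrite sum1dep_card.
rewrite expnS expn1 -cardsX; apply: subset_leq_card.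
apply/fintype.subsetP => -[x y] /[!inE] /= /andP[/andP[-> /eqP xg] /andP[-> /eqP yg]].
by rewrite xg yg !eqxx.
Qed.

(** Quadruples are indexed by an arbitrary set T, so that T can be F_2^2 and
    its points can be used in inner products. *)
Definition zero_sum_families (T X : finType) (G : finZmodType)
    (A : {set X}) (phi : X -> G) : {set {ffun T -> X}} :=
  [set F : {ffun T -> X} | [forall t, F t \in A] & \sum_t phi (F t) == 0].

(** In exponent 2, a quadruple has phi-sum zero exactly when its first and
    last two entries collide under addition, so pairs of elements of A are
    counted by collisions. *)
Lemma zero_sum_count (T X : finType) (G : finZmodType) (A : {set X})
    (phi : X -> G) :
  (forall g : G, g + g = 0) -> #|T| = 4%N ->
  (#|A| ^ 4 <= #|G| * #|zero_sum_families T A phi|)%N.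
Proof.
move=> G2 T4; pose th (t : T) : 'I_4 := cast_ord T4 (enum_rank t).
have thK i : th (enum_val (cast_ord (esym T4) i)) = i.
  by rewrite /th enum_valK cast_ordKV.
have th_bij : bijective th.
  exists (fun i => enum_val (cast_ord (esym T4) i)) => // t.
  by rewrite /th cast_ordK enum_rankK.
pose psi (p : X * X) : G := phi p.1 + phi p.2.
have -> : (#|A| ^ 4 = #|finset.setX A A| ^ 2)%N by rewrite cardsX mulnn -expnM.
apply: leq_trans (collision_count (finset.setX A A) psi) _.
rewrite leq_mul2l; apply/orP; right.
pose tup (q : (X * X) * (X * X)) := [tuple q.1.1; q.1.2; q.2.1; q.2.2].
pose fam q : {ffun T -> X} := [ffun t => tnth (tup q) (th t)].
have fam_inj : injective fam.
  move=> [[a b] [c d]] [[a' b'] [c' d']] /ffunP e.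
  have {}e (i : 'I_4) : tnth (tup (a, b, (c, d))) i = tnth (tup (a', b', (c', d'))) i.
    by have := e (enum_val (cast_ord (esym T4) i)); rewrite !ffunE thK.
  move: (e (Ordinal (isT : (0 < 4)%N))) (e (Ordinal (isT : (1 < 4)%N))).
  move: (e (Ordinal (isT : (2 < 4)%N))) (e (Ordinal (isT : (3 < 4)%N))).
  by rewrite !(tnth_nth a) /= => -> -> -> ->.
rewrite -(card_imset _ fam_inj); apply: subset_leq_card.
apply/fintype.subsetP => F /imsetP[[[a b] [c d]] /[!inE] /= H ->].
case/and3P: H => /andP[aA bA] /andP[cA dA] /eqP psiE.
apply/andP; split.
  apply/forallP => t; rewrite ffunE (tnth_nth a).
  by case: (th t) => -[|[|[|[|//]]]] ? /=.
apply/eqP; under eq_bigr do rewrite ffunE.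
have -> : \sum_t phi (tnth (tup (a, b, (c, d))) (th t)) =
          \sum_(i < 4) phi (tnth (tup (a, b, (c, d))) i).
  by rewrite [RHS](reindex th) //; exact: onW_bij.
rewrite !big_ord_recl big_ord0 !(tnth_nth a) /= addr0.
by rewrite addrA [_ + phi b]psiE G2.
Qed.

(** * Counting balanced arrays of permutations *)

Lemma rowF2_addvv (m : nat) (v : 'rV['F_2]_m) : v + v = 0.
Proof.
by apply/rowP => i; rewrite !mxE addrr_pchar2 ?pchar_Fp.
Qed.

Lemma ffun_addvv (aT : finType) (rT : zmodType) :
  (forall v : rT, v + v = 0) -> forall F : {ffun aT -> rT}, F + F = 0.
Proof. by move=> rT2 F; apply/ffunP => t; rewrite !ffunE rT2. Qed.

Definition perm_ffun (V : finType) (s : {perm V}) : {ffun V -> V} :=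
  [ffun v => s v].

Definition zero_rows (T : finType) (V : finZmodType) :
    {set {ffun T -> {perm V}}} :=
  zero_sum_families T [set: {perm V}] (@perm_ffun V).

Definition columnwise_inverse (T : finType) (V : finZmodType)
    (q : {ffun T -> {perm V}}) : {ffun T -> {ffun V -> V}} :=
  [ffun w => perm_ffun (q w)^-1%g].

Definition balanced_arrays (T : finType) (V : finZmodType) :
    {set {ffun T -> {ffun T -> {perm V}}}} :=
  zero_sum_families T (zero_rows T V) (@columnwise_inverse T V).

(** Both applications of zero_sum_count lose a factor equal to the size of
    the group of constraints: |V|^|V| for each of the four rows, and the
    same for each of the four columns. *)
Lemma balanced_arrays_count (T : finType) (V : finZmodType) :
  (forall v : V, v + v = 0) -> #|T| = 4%N ->
  ((#|V|)`! ^ 16 <= #|V| ^ (8 * #|V|) * #|balanced_arrays T V|)%N.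
Proof.
move=> V2 T4.
have rows : ((#|V|)`! ^ 4 <= #|V| ^ #|V| * #|zero_rows T V|)%N.
  have permE : #|[set: {perm V}]| = (#|V|)`!.
    rewrite -cardsT -(card_perm [set: V]); apply: eq_card => s.
    by rewrite !inE; apply/esym/fintype.subsetP => v; rewrite inE.
  rewrite -permE -card_ffun; apply: zero_sum_count T4; exact: ffun_addvv.
have columns : (#|zero_rows T V| ^ 4 <=
    #|V| ^ (4 * #|V|) * #|balanced_arrays T V|)%N.
  have -> : (#|V| ^ (4 * #|V|) = #|{ffun T -> {ffun V -> V}}|)%N.
    by rewrite !card_ffun T4 mulnC expnM.
  by apply: zero_sum_count T4; do 2 apply: ffun_addvv.
rewrite (_ : 16 = 4 * 4)%N // expnM.
apply: leq_trans (_ : (#|V| ^ #|V| * #|zero_rows T V|) ^ 4 <= _)%N.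
  by rewrite leq_exp2r.
rewrite expnMn -expnM (_ : 8 * _ = #|V| * 4 + 4 * #|V|)%N; last by lia.
by rewrite expnD -mulnA leq_mul2l columns orbT.
Qed.

(** A weak form of Stirling's bound, in which e is replaced by 4; for powers
    of two it follows by doubling from (2K)! >= K! K^K. *)
Lemma fact_pow2_ge (t : nat) :
  ((2 ^ t) ^ 2 ^ t <= (2 ^ t)`! * 4 ^ 2 ^ t)%N.
Proof.
elim: t => [//|t IH]; set K := (2 ^ t)%N in IH *.
have fact_double : (K`! * K ^ K <= (2 * K)`!)%N.
  suff fact_add j : (K`! * K ^ j <= (K + j)`!)%N by rewrite mul2n -addnn.
  elim: j => [|j IHj]; first by rewrite muln1 addn0.
  rewrite addnS factS expnS mulnCA; apply: leq_mul => //.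
  by rewrite leqW // leq_addr.
rewrite expnS -/K.
apply: leq_trans (_ : K`! * K ^ K * 4 ^ (2 * K) <= _)%N; last first.
  by rewrite leq_mul2r fact_double orbT.
rewrite expnMn (_ : 2 ^ (2 * K) = 4 ^ K)%N; last by rewrite expnM.
rewrite (_ : 2 * K = K + K)%N; last by lia.
rewrite !expnD.
apply: leq_trans (_ : 4 ^ K * ((K`! * 4 ^ K) * K ^ K) <= _)%N.
  by rewrite leq_mul2l leq_mul2r IH !orbT.
by rewrite leq_eqVlt; apply/orP; left; apply/eqP; ring.
Qed.

(** * Signs and characters of F_2^m *)

Definition chi (a : 'F_2) : int := (-1) ^+ nat_of_ord a.

Lemma walshE (n : nat) (f : boolean_function n) (y : 'rV['F_2]_n) :
  walsh f y = \sum_x chi (f x + inner_product x y).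
Proof. by []. Qed.

Lemma F2_cases (a : 'F_2) : a = 0 \/ a = 1.
Proof. by case: a => -[|[|//]] ?; [left|right]; apply/val_inj. Qed.

Lemma F2_addvv (a : 'F_2) : a + a = 0.
Proof. by rewrite addrr_pchar2 ?pchar_Fp. Qed.

Lemma chi0 : chi 0 = 1. Proof. by []. Qed.

Lemma chi1 : chi 1 = -1. Proof. by []. Qed.

Lemma chiD (a b : 'F_2) : chi (a + b) = chi a * chi b.
Proof.
case: (F2_cases a) => ->; case: (F2_cases b) => ->;
  by rewrite ?addr0 ?add0r ?F2_addvv ?chi0 ?chi1 ?mul1r ?mulr1 ?mulrNN.
Qed.

Lemma chi_inj : injective chi.
Proof. by move=> a b; case: (F2_cases a) => ->; case: (F2_cases b) => ->. Qed.

Definition majority (T : finType) (p : T -> 'F_2) : 'F_2 :=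
  if (2 <= \sum_w nat_of_ord (p w))%N then 1 else 0.

(** Four bits with sum 1 contain one or three ones, so their signs add up to
    2 or -2.  Applied along the rows of an array this gives the sparse Walsh
    spectrum for fixed (y, z); applied along the columns it gives flatness. *)
Lemma chi_majority (T : finType) (p : T -> 'F_2) :
  #|T| = 4%N -> \sum_w p w = 1 ->
  2 * chi (majority p) = \sum_w chi (p w).
Proof.
move=> T4 p1; set k := (\sum_w nat_of_ord (p w))%N.
have chiE a : chi a = 1 - 2 * (nat_of_ord a)%:R.
  by case: (F2_cases a) => ->.
have -> : \sum_w chi (p w) = 4 - 2 * k%:R.
  under eq_bigr do rewrite chiE.
  by rewrite sumrB sumr_const T4 -mulr_sumr /k natr_sum.
have k4 : (k <= 4)%N.
  by rewrite -T4 -sum1_card leq_sum // => w _; case: (F2_cases (p w)) => ->.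
have k1 : k%:R = 1 :> 'F_2.
  rewrite -[RHS]p1 /k natr_sum; apply: eq_bigr => w _.
  by case: (F2_cases (p w)) => ->.
rewrite /majority -/k.
by move: k k1 k4 => [|[|[|[|[|k]]]]].
Qed.

Lemma inner_productDl (m : nat) (x y z : 'rV['F_2]_m) :
  inner_product (x + y) z = inner_product x z + inner_product y z.
Proof.
by rewrite -big_split; apply: eq_bigr => i _; rewrite !mxE mulrDl.
Qed.

Lemma inner_productC (m : nat) (x y : 'rV['F_2]_m) :
  inner_product x y = inner_product y x.
Proof. by apply: eq_bigr => i _; rewrite mulrC. Qed.

Lemma inner_product0l (m : nat) (y : 'rV['F_2]_m) : inner_product 0 y = 0.
Proof. by apply: big1 => i _; rewrite mxE mul0r. Qed.

Lemma inner_product_suml (m : nat) (I : finType) (F : I -> 'rV['F_2]_m) y :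
  inner_product (\sum_i F i) y = \sum_i inner_product (F i) y.
Proof.
apply: (big_morph (fun x => inner_product x y)); last exact: inner_product0l.
by move=> ? ?; exact: inner_productDl.
Qed.

Lemma inner_product_row_mx (m p : nat) (a c : 'rV['F_2]_m) (b d : 'rV['F_2]_p) :
  inner_product (row_mx a b) (row_mx c d) =
  inner_product a c + inner_product b d.
Proof.
rewrite /inner_product big_split_ord /=.
by congr (_ + _); apply: eq_bigr => i _; rewrite ?row_mxEl ?row_mxEr.
Qed.

Lemma inner_product_delta (m : nat) (x : 'rV['F_2]_m) i :
  inner_product x (delta_mx 0 i) = x 0 i.
Proof.
rewrite /inner_product (bigD1 i) //= mxE !eqxx mulr1 big1 ?addr0 // => j ji.
by rewrite mxE (negPf ji) andbF mulr0.
Qed.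

Lemma sum_row_mx (m p : nat) (G : zmodType) (F : 'rV['F_2]_(m + p) -> G) :
  \sum_x F x = \sum_a \sum_b F (row_mx a b).
Proof.
rewrite pair_bigA [LHS](reindex (fun q => row_mx q.1 q.2)) //=.
exists (fun x => (lsubmx x, rsubmx x)) => [[a b]|x] _ /=.
  by rewrite row_mxKl row_mxKr.
by rewrite hsubmxK.
Qed.

(** Orthogonality of characters: when a i = 1, translation by the i-th basis
    vector changes the sign of every term. *)
Lemma sum_chi_inner_product (m : nat) (a : 'rV['F_2]_m) :
  \sum_x chi (inner_product x a) = (a == 0)%:R * 2 ^+ m.
Proof.
have [->|/rV0Pn[i ai]] := eqVneq a 0.
  under eq_bigr do rewrite inner_productC inner_product0l chi0.
  by rewrite sumr_const card_mx card_Fp // mul1n mul1r -natrX.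
rewrite mul0r; set S := \sum_x _.
have : S = - S; last by lia.
rewrite [LHS](reindex_inj (addrI (delta_mx 0 i))) -sumrN /=.
apply: eq_bigr => x _.
rewrite inner_productDl chiD [inner_product (delta_mx _ _) _]inner_productC.
rewrite inner_product_delta.
by case: (F2_cases (a 0 i)) ai => -> //; rewrite chi1 mulN1r.
Qed.

Notation bit_pair := 'rV['F_2]_2.

Lemma card_bit_pair : #|{: bit_pair}| = 4%N.
Proof. by rewrite card_mx card_Fp. Qed.

Lemma sum_bit_pair : \sum_(w : bit_pair) w = 0.
Proof.
have double (v : bit_pair) : v *+ #|{: 'rV['F_2]_1}| = 0.
  by rewrite card_mx card_Fp // mulr2n rowF2_addvv.
rewrite (@sum_row_mx 1 1 _ id) /=.
rewrite (eq_bigr (fun=> \sum_(b : 'rV_1) row_mx 0 b)) => [|a _].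
  by rewrite sumr_const double.
rewrite (eq_bigr (fun b => row_mx a 0 + row_mx 0 b)) => [|b _].
  by rewrite big_split /= sumr_const double add0r.
by rewrite add_row_mx addr0 add0r.
Qed.

(** * The bent function of a balanced array *)

Section ArrayFunction.

Variable t : nat.
Notation V := 'rV['F_2]_t.
Notation array := {ffun bit_pair -> {ffun bit_pair -> {perm V}}}.
Implicit Types (P : array) (x y u v : V) (xi z w om : bit_pair).

(** The term [z = w] is a sign pattern for which every row and every column of
    the 4 x 4 array has product -1. *)
Definition array_bit P x xi y z w : 'F_2 :=
  (z == w)%:R + inner_product (P z w y) x + inner_product w xi.

Definition array_function P : boolean_function ((t + 2) + (t + 2)) :=
  [ffun X => majority (array_bit P (lsubmx (lsubmx X)) (rsubmx (lsubmx X))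
                         (lsubmx (rsubmx X)) (rsubmx (rsubmx X)))].

Lemma array_functionE P x xi y z :
  array_function P (row_mx (row_mx x xi) (row_mx y z)) =
  majority (array_bit P x xi y z).
Proof. by rewrite ffunE !(row_mxKl, row_mxKr). Qed.

Lemma sum_diag z : \sum_w (z == w)%:R = 1 :> 'F_2.
Proof.
by rewrite (bigD1 z) //= eqxx big1 ?addr0 // => w /negPf; rewrite eq_sym => ->.
Qed.

Lemma balanced_row_sum P z y :
  P \in balanced_arrays bit_pair V -> \sum_w P z w y = 0.
Proof.
rewrite inE => /andP[/forallP /(_ z)]; rewrite inE => /andP[_ /eqP/ffunP/(_ y)].
rewrite sum_ffunE ffunE => zero _; rewrite -[RHS]zero.
by apply: eq_bigr => w _; rewrite ffunE.
Qed.

Lemma balanced_column_sum P w u :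
  P \in balanced_arrays bit_pair V -> \sum_z (P z w)^-1%g u = 0.
Proof.
rewrite inE => /andP[_ /eqP/ffunP/(_ w)/ffunP/(_ u)].
rewrite sum_ffunE [(0 : {ffun _}) w]ffunE sum_ffunE [RHS]ffunE => zero; rewrite -[RHS]zero.
by apply: eq_bigr => z _; rewrite !ffunE.
Qed.

Lemma chi_array_function P x xi y z : P \in balanced_arrays bit_pair V ->
  2 * chi (array_function P (row_mx (row_mx x xi) (row_mx y z))) =
  \sum_w chi (array_bit P x xi y z w).
Proof.
move=> balP; rewrite array_functionE chi_majority //; first exact: card_bit_pair.
rewrite !big_split /= sum_diag -!inner_product_suml balanced_row_sum // sum_bit_pair.
by rewrite !inner_product0l !addr0.
Qed.

(** Summation over xi selects one of the four Walsh coefficients at (y, z);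
    this isolates the entry P z om of the array. *)
Lemma partial_walsh P x y z om : P \in balanced_arrays bit_pair V ->
  \sum_xi chi (array_function P (row_mx (row_mx x xi) (row_mx y z)) +
               inner_product xi om) =
  2 * chi ((z == om)%:R + inner_product (P z om y) x).
Proof.
move=> balP.
suff: 2 * (\sum_xi chi (array_function P (row_mx (row_mx x xi) (row_mx y z)) +
               inner_product xi om)) =
  2 * (2 * chi ((z == om)%:R + inner_product (P z om y) x)) by lia.
rewrite mulr_sumr.
under eq_bigr do rewrite chiD mulrA chi_array_function // mulr_suml.
rewrite exchange_big (bigD1 om) //=.
have term w : \sum_xi chi (array_bit P x xi y z w) * chi (inner_product xi om) =
    chi ((z == w)%:R + inner_product (P z w y) x) * ((w == om)%:R * 2 ^+ 2).
  rewrite -[w == om]subr_eq0 -sum_chi_inner_product mulr_sumr; apply: eq_bigr => xi _.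
  rewrite -!chiD [inner_product xi (_ - _)]inner_productC inner_productDl.
  rewrite (_ : - om = om) ?(inner_productC om).
    by rewrite addrA.
  by apply/eqP; rewrite eq_sym -addr_eq0 rowF2_addvv.
rewrite term eqxx [X in _ + X]big1 => [|w /negPf wom]; first by lia.
by rewrite term wom mul0r mulr0.
Qed.

(** Summing over xi and then over x leaves, for each z, the single value
    y = (P z om)^-1 u.  The remaining sum over z consists of four signs whose
    bits add up to 1, because column om of inverses sums to zero. *)
Lemma array_function_bent P :
  P \in balanced_arrays bit_pair V -> bent (array_function P).
Proof.
move=> balP; apply/forallP => Y.
rewrite -[Y]hsubmxK -[lsubmx Y]hsubmxK -[rsubmx Y]hsubmxK.
move: (lsubmx (lsubmx Y)) (rsubmx (lsubmx Y)) => u om.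
move: (lsubmx (rsubmx Y)) (rsubmx (rsubmx Y)) => v ze.
pose p z : 'F_2 := (z == om)%:R + inner_product z ze +
  inner_product ((P z om)^-1%g u) v.
suff -> : walsh (array_function P) (row_mx (row_mx u om) (row_mx v ze)) =
    chi (majority p) * 2 ^+ (t + 2).
  rewrite addnn doubleK.
  by case: (F2_cases (majority p)) => ->;
    rewrite ?chi0 ?chi1 ?mul1r ?mulN1r eqxx ?orbT.
have sum_x z y : \sum_x chi (inner_product x u) *
      chi ((z == om)%:R + inner_product (P z om y) x) =
    chi (z == om)%:R * ((y == (P z om)^-1%g u)%:R * 2 ^+ t).
  have -> : (y == (P z om)^-1%g u) = (P z om y - u == 0).
    by rewrite subr_eq0 -(inj_eq (@perm_inj _ (P z om))) permKV.
  rewrite -sum_chi_inner_product mulr_sumr; apply: eq_bigr => x _.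
  rewrite -!chiD ![inner_product x _]inner_productC inner_productDl (_ : - u = u).
    by congr chi; ring.
  by apply/eqP; rewrite eq_sym -addr_eq0 rowF2_addvv.
have sum_y z : \sum_y chi (inner_product y v + inner_product z ze) *
      (\sum_x chi (inner_product x u) *
         chi ((z == om)%:R + inner_product (P z om y) x)) =
    2 ^+ t * chi (p z).
  rewrite (bigD1 ((P z om)^-1%g u)) //= sum_x eqxx big1 => [|y /negPf yu].
    by rewrite addr0 mul1r /p !chiD; ring.
  by rewrite sum_x yu mul0r !mulr0.
have -> : walsh (array_function P) (row_mx (row_mx u om) (row_mx v ze)) =
   2 * \sum_z \sum_y chi (inner_product y v + inner_product z ze) *
      (\sum_x chi (inner_product x u) *
         chi ((z == om)%:R + inner_product (P z om y) x)).
  pose F x y z := 2 * (chi (inner_product y v + inner_product z ze) *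
    (chi (inner_product x u) * chi ((z == om)%:R + inner_product (P z om y) x))).
  transitivity (\sum_x \sum_y \sum_z F x y z); last first.
    rewrite exchange_big mulr_sumr /=; under eq_bigr do rewrite exchange_big /=.
    rewrite exchange_big; apply: eq_bigr => z _; rewrite mulr_sumr.
    by apply: eq_bigr => y _; rewrite !mulr_sumr.
  rewrite walshE 2!sum_row_mx; apply: eq_bigr => x _.
  under eq_bigr do rewrite sum_row_mx.
  rewrite exchange_big; apply: eq_bigr => y _.
  rewrite exchange_big; apply: eq_bigr => z _ /=.
  have -> : F x y z = chi (inner_product y v + inner_product z ze) *
      chi (inner_product x u) *
      (2 * chi ((z == om)%:R + inner_product (P z om y) x)) by rewrite /F; ring.
  rewrite -partial_walsh // mulr_sumr; apply: eq_bigr => xi _.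
  by rewrite -!chiD !inner_product_row_mx; congr chi; ring.
under eq_bigr do rewrite sum_y.
rewrite -mulr_sumr -chi_majority; first by rewrite exprD; ring.
  exact: card_bit_pair.
rewrite !big_split /= -!inner_product_suml balanced_column_sum // sum_bit_pair.
rewrite !inner_product0l !addr0.
by under eq_bigr do rewrite eq_sym; exact: sum_diag.
Qed.

Lemma array_function_inj :
  {in balanced_arrays bit_pair V &, injective array_function}.
Proof.
move=> P Q balP balQ fPQ; apply/ffunP => z; apply/ffunP => w; apply/permP => y.
apply/rowP => i; rewrite -!inner_product_delta.
have := partial_walsh (delta_mx 0 i) y z w balP.
rewrite fPQ partial_walsh // => /(mulfI (isT : 2 != 0 :> int)) /chi_inj.
by move=> /addrI ->.
Qed.

End ArrayFunction.

(** * The lower bound *)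

Lemma num_bent_ge (t : nat) :
  (2 ^ (8 * t * 2 ^ t) <= num_bent ((t + 2) + (t + 2)) * 2 ^ (32 * 2 ^ t))%N.
Proof.
have cardV : #|{: 'rV['F_2]_t}| = (2 ^ t)%N by rewrite card_mx card_Fp // mul1n.
have arrays_bent : (#|balanced_arrays bit_pair 'rV['F_2]_t| <=
    num_bent ((t + 2) + (t + 2)))%N.
  rewrite -(card_in_imset (@array_function_inj t)); apply: subset_leq_card.
  apply/fintype.subsetP => f /imsetP[P balP ->].
  by rewrite inE array_function_bent.
have := balanced_arrays_count (@rowF2_addvv t) card_bit_pair.
rewrite cardV; set K := (2 ^ t)%N => count.
have fact_ge : (K ^ (16 * K) <= K`! ^ 16 * 2 ^ (32 * K))%N.
  have -> : (K ^ (16 * K) = (K ^ K) ^ 16)%N by rewrite -expnM mulnC.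
  have -> : (2 ^ (32 * K) = (4 ^ K) ^ 16)%N.
    by rewrite (_ : 4 = 2 ^ 2)%N // -!expnM; congr (_ ^ _)%N; lia.
  by rewrite -expnMn leq_exp2r // fact_pow2_ge.
have K_gt0 : (0 < K ^ (8 * K))%N by rewrite !expn_gt0.
rewrite (_ : 2 ^ _ = K ^ (8 * K))%N; last by rewrite -expnM; congr (_ ^ _)%N; lia.
rewrite -(leq_pmul2l K_gt0) -expnD (_ : 8 * K + 8 * K = 16 * K)%N; last by lia.
apply: leq_trans fact_ge _; rewrite mulnA leq_mul2r; apply/orP; right.
by apply: leq_trans count _; rewrite leq_mul2l arrays_bent orbT.
Qed.

Theorem theorem4p3 (R : realType) :
  exists C : R, 0 < C /\
    forall n : nat, ~~ odd n -> (4 <= n)%N ->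
      log2 ((num_bent n)%:R : R) >= n%:R * 2 ^+ n./2 * (1 - C / n%:R).
Proof.
(* n 2^(n/2) = (2 t + 4) 4 K exceeds the bound 8 t K - 32 K by 48 K, which is
   12 times 2^(n/2). *)
exists 12; split=> // n n_even n_ge4.
have [t nE] : exists t, n = ((t + 2) + (t + 2))%N.
  by exists (n./2 - 2)%N; move: (even_halfK n_even); lia.
have n0 : n%:R != 0 :> R by rewrite pnatr_eq0; lia.
have -> : n%:R * 2 ^+ n./2 * (1 - 12 / n%:R) = (n%:R - 12) * 2 ^+ n./2 :> R.
  by field.
subst n; rewrite [in _ ^+ _]addnn doubleK.
have := num_bent_ge t; set b := num_bent _ => count.
have b_gt0 : (0 < b)%N.
  by case: b count => //; rewrite mul0n leqn0 expn_eq0.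
have ln2 : 0 < ln 2 :> R by rewrite ln_gt0 // ltr1n.
rewrite /log2 ler_pdivlMr //.
have : ln ((2 ^ (8 * t * 2 ^ t))%N%:R) <= ln ((b * 2 ^ (32 * 2 ^ t))%N%:R) :> R.
  by rewrite ler_ln ?posrE ?ltr0n ?ler_nat // ?muln_gt0 ?expn_gt0 ?b_gt0.
rewrite natrM !natrX lnM ?posrE ?exprn_gt0 ?ltr0n // !lnXn ?ltr0n //.
rewrite -[ln 2 *+ _]mulr_natl -[ln 2 *+ (32 * _)]mulr_natl.
rewrite -lerBlDr -mulrBl; apply: le_trans; rewrite ler_pM2r //.
rewrite !natrD !natrM natrX exprD; lra.
Qed.
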